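(* Let $n\ge 2$, let $M:=\mathbf{P}(n,\mathbb{N})\cong\mathbb{N}^{n-1}$, and let $S$ be a thin unipotent numerical monoid in $M$ with coordinate monoids $S_1,\dots,S_{n-1}$ and generating number $k=\mathtt{r}_M(S)$. For each $i$ let $\mathtt{c}_i,\mathtt{e}_i,\mathtt{n}_i$ denote the conductor, embedding dimension and sporadicity of $S_i$, respectively. Assume that the ordinary Wilf conjecture holds for the coordinate monoids, i.e. $\mathtt{c}_i\le \mathtt{e}_i\mathtt{n}_i$ for every $i\in\{1,\dots,n-1\}$. If $\prod_{i=1}^{n-1}\mathtt{c}_i=k^{n-1}$, then the Unipotent Wilf Conjecture holds for $S$, that is, $$(n-1)\,k^{n-1}\ \le\ \mathtt{e}(S)\,\mathtt{n}_M(S).$$ Furthermore, in this case, the Unipotent Wilf Conjecture for $S$ is equivalent to the Generalized Wilf Conjecture for $S$, that is, the inequality $(n-1)\,k^{n-1}\le \mathtt{e}(S)\,\mathtt{n}_M(S)$ is equivalent to the inequality $(n-1)\,c(S)\le \mathtt{e}(S)\,n(S)$.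
   Context: $\mathbb{N}=\{0,1,2,\dots\}$. $\mathbf{P}(n,\mathbb{N})$ is the monoid of $n\times n$ matrices with entries in $\mathbb{N}$, all diagonal entries $1$, and whose only possibly nonzero off-diagonal entries lie in the first row; reading off the entries in positions $(1,2),\dots,(1,n)$ identifies it with the additive monoid $\mathbb{N}^{n-1}$, and we work in $M=\mathbb{N}^{n-1}$. A unipotent numerical monoid in $M$ is a submonoid $S$ of $M$ with $M\setminus S$ finite. For a positive integer $k$ let $P(k):=\{0\}\cup\{(x_1,\dots,x_{n-1})\in\mathbb{N}^{n-1}:\max_i x_i\ge k\}$. The generating number $\mathtt{r}_M(S)$ is the smallest positive integer $k$ with $P(k)\subseteq S$. The sporadicity $\mathtt{n}_M(S):=|\{0\}\cup (S\setminus P(\mathtt{r}_M(S)))|$ is the number of elements of $S$ all of whose coordinates are $<\mathtt{r}_M(S)$. The embedding dimension $\mathtt{e}(\cdot)$ of a monoid is the minimum cardinality of a generating set. For $1\le j\le n-1$, the coordinate submonoid $S_j$ is the set of elements of $S$ whose coordinates other than the $j$-th are all $0$, viewed as a submonoid of $\mathbb{N}$ (it has finite complement). For a submonoid $T\subseteq\mathbb{N}$ with finite complement, its conductor $\mathtt{c}(T)$ is the smallest positive integer $c$ such that every integer $\ge c$ lies in $T$ (so $\mathtt{c}(\mathbb{N})=1$), and its sporadicity is $\mathtt{n}(T)=|\{t\in T: t<\mathtt{c}(T)\}|$. $S$ is called thin if $\prod_{j=1}^{n-1}\mathtt{n}(S_j)=\mathtt{n}_M(S)$. Let $\leqslant$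 be the componentwise partial order on $\mathbb{N}^{n-1}$ and $H(S):=\mathbb{N}^{n-1}\setminus S$; then $c(S):=|\{\mathbf{a}\in\mathbb{N}^{n-1}:\mathbf{a}\leqslant\mathbf{b}\text{ for some }\mathbf{b}\in H(S)\}|$ and $n(S):=|\{\mathbf{a}\in S:\mathbf{a}\leqslant\mathbf{b}\text{ for some }\mathbf{b}\in H(S)\}|$. *)

(* Defs.v *)
From HB Require Import structures.
From mathcomp Require Import all_boot all_order all_algebra finmap.
From mathcomp Require Import all_classical.

Set Implicit Arguments.
Unset Strict Implicit.
Unset Printing Implicit Defensive.

Import GRing.Theory.

Local Open Scope classical_set_scope.
Local Open Scope ring_scope.

(* The least element of P; a junk value when P is empty. *)
Definition least (P : set nat) : nat :=
  get [set m | P m /\ forall l, P l -> (m <= l)%N].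

Lemma leastP (P : set nat) :
  P !=set0 -> P (least P) /\ forall l, P l -> (least P <= l)%N.
Proof.
move=> [m Pm].
have exP : exists m, `[< P m >] by exists m; apply/asboolP.
case: (ex_minnP exP) => m0 /asboolP Pm0 min_m0.
apply: (@getPex _ [set m | P m /\ forall l, P l -> (m <= l)%N]).
by exists m0; split=> // l Pl; apply/min_m0/asboolP.
Qed.

(* The number of elements of a finite set; 0 when A is infinite. *)
Definition card (T : choiceType) (A : set T) : nat := #|` fset_set A|%fset.

Definition submonoid (V : nmodType) (S : set V) : Prop :=
  S 0 /\ forall x y, S x -> S y -> S (x + y).

(* Only finite generating sets are considered: the value is junk for monoids
   that are not finitely generated, which submonoids of N^d with finite
   complement always are. *)
Definition embdim (V : nmodType) (S : set V) : nat :=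
  least [set m | exists A : set V,
    [/\ finite_set A, smallest (@submonoid V) A = S & card A = m]].

Definition conductor (T : set nat) : nat :=
  least [set c | (0 < c)%N /\ forall t, (c <= t)%N -> T t].

Definition sporadicity (T : set nat) : nat :=
  card [set t | T t /\ (t < conductor T)%N].

(* P(n, N) identified with N^(n-1), read off the first rows. *)
Notation unip n := {ffun 'I_n.-1 -> nat}.

Section Unipotent.
Variable n : nat.
Implicit Types (S : set (unip n)) (j : 'I_n.-1).

Definition unipotent_numerical S : Prop := submonoid S /\ finite_set (~` S).

Definition Pset (k : nat) : set (unip n) :=
  [set x | x = 0 \/ (k <= \max_i x i)%N].

Definition generating_number S : nat :=
  least [set k | (0 < k)%N /\ Pset k `<=` S].

Definition sporadicityM S : nat :=
  card ([set 0] `|` (S `\` Pset (generating_number S))).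

Definition coord_monoid S j : set nat :=
  [set x j | x in [set x | S x /\ forall i, i != j -> x i = 0%N]].

Definition thin S : Prop :=
  (\prod_j sporadicity (coord_monoid S j))%N = sporadicityM S.

Definition below_gaps S : set (unip n) :=
  [set a | exists2 b, (~` S) b & forall i, (a i <= b i)%N].

Definition gen_c S : nat := card (below_gaps S).

Definition gen_n S : nat := card (S `&` below_gaps S).

Definition unipotent_Wilf S : Prop :=
  (n.-1 * generating_number S ^ n.-1 <= embdim S * sporadicityM S)%N.

Definition generalized_Wilf S : Prop :=
  (n.-1 * gen_c S <= embdim S * gen_n S)%N.

End Unipotent.

(* Main.v *)
Require Import Defs.
From HB Require Import structures.
From mathcomp Require Import all_boot all_order all_algebra finmap.
From mathcomp Require Import all_classical.
From mathcomp Require Import zify.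

(* As c_i <= k for every i, the hypothesis on the product forces c_i = k for all
   i, and thinness says that the elements of S in the box [0, k)^d, d = n - 1,
   are exactly those with all coordinates in the S_i.  Let m_i be the least
   positive element of S_i.  For each j, every generating set of S contains at
   least e_j elements on the j-th axis, and all the elements x off this axis with
   k <= x_j < k + m_j and x_i < m_i for i <> j, because they are irreducible.
   Hence e(S) >= \sum_j (\prod_i m_i - m_j + e_j).  Since k <= m_i n_i for all i
   and k <= e_j n_j, each summand multiplied by \prod_i n_i is at least k^d.
   If k > 1, the elements below a gap form the box, so that c(S) = k^d and
   n(S) = n_M(S). *)

(** * Counting finite sets, products of sets and disjoint pieces *)

Section Cardinality.

Set Implicit Arguments.
Unset Strict Implicit.
Unset Printing Implicit Defensive.
Local Open Scope classical_set_scope.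
Local Notation card := Defs.card.

Lemma card_seqE (T : choiceType) (A : set T) (s : seq T) :
  uniq s -> (forall x, A x <-> x \in s) -> card A = size s.
Proof.
move=> us As.
have fA : finite_set A.
  by apply/finite_seqP; exists s; apply/seteqP; split=> x /As.
apply/perm_size/uniq_perm => //.
move=> x; rewrite in_fset_set //.
by apply/idP/idP; rewrite inE => /As.
Qed.

Lemma finite_card_seq (T : choiceType) (A : set T) : finite_set A ->
  exists s : seq T, [/\ uniq s, forall x, A x <-> x \in s & size s = card A].
Proof.
move=> fA; exists (fset_set A); split=> // x.
by rewrite in_fset_set // inE.
Qed.

Lemma card_le (T : choiceType) (A B : set T) :
  finite_set B -> A `<=` B -> (card A <= card B)%N.
Proof.
move=> fB AB; have fA := sub_finite_set AB fB.
by apply: fsubset_leq_card; rewrite -fset_set_sub.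
Qed.

Lemma card_sub_eq (T : choiceType) (A B : set T) :
  finite_set B -> A `<=` B -> card A = card B -> A = B.
Proof.
move=> fB AB cAB; have fA := sub_finite_set AB fB.
apply/fset_set_inj => //; apply/fsetP/fsubset_cardP => //.
by rewrite -fset_set_sub.
Qed.

Lemma card_image_le (T U : choiceType) (f : T -> U) (A : set T) :
  finite_set A -> (card (f @` A) <= card A)%N.
Proof. by move=> fA; rewrite /card fset_set_image // leq_imfset_card. Qed.

Lemma card_image_inj (T U : choiceType) (f : T -> U) (A : set T) :
  finite_set A -> injective f -> card (f @` A) = card A.
Proof.
by move=> fA fI; rewrite /card fset_set_image // card_in_imfset // => x y _ _ /fI.
Qed.

Lemma cardU_disj (T : choiceType) (A B : set T) : finite_set A ->
  finite_set B -> A `&` B = set0 -> card (A `|` B) = (card A + card B)%N.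
Proof.
move=> fA fB AB0; rewrite /card fset_setU // cardfsU.
by rewrite -fset_setI // AB0 fset_set0 cardfs0 subn0.
Qed.

Lemma card_interval a m : card [set t | (a <= t < a + m)%N] = m.
Proof.
rewrite -[RHS](size_iota a); apply: card_seqE => [|x]; first exact: iota_uniq.
by rewrite mem_iota.
Qed.

Lemma card_ltn m : card [set t | (t < m)%N] = m.
Proof. exact: (card_interval 0). Qed.

Lemma finite_bounded (A : set nat) m : (forall t, A t -> (t < m)%N) -> finite_set A.
Proof. by move=> Am; apply: sub_finite_set (finite_II m) => t /Am. Qed.

(** A common strict bound [K] on all factors turns the product into the image of a family in the
    finite type [{ffun I -> 'I_K}], where [card_family] counts it. *)
Lemma finite_pi_card (I : finType) (A : I -> set nat) :
  (forall i, finite_set (A i)) ->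
  let P := [set x : {ffun I -> nat} | forall i, A i (x i)] in
  finite_set P /\ card P = \prod_i card (A i).
Proof.
move=> fA P.
have /choice [s sP] : forall i, exists s : seq nat,
  [/\ uniq s, forall x, A i x <-> x \in s & size s = card (A i)].
  by move=> i; exact: (finite_card_seq (fA i)).
pose K := (\max_i \max_(t <- s i) t).+1.
have sK i t : t \in s i -> (t < K)%N.
  move=> ts; rewrite ltnS; apply: leq_trans (leq_bigmax i).
  exact: (@leq_bigmax_seq _ _ xpredT id).
pose F i := [pred t : 'I_K | val t \in s i].
pose up (f : {ffun I -> 'I_K}) : {ffun I -> nat} := [ffun i => val (f i)].
have upI : injective up.
  by move=> f g /ffunP fg; apply/ffunP => i; apply/val_inj; have := fg i; rewrite !ffunE.
pose q := map up (enum (family F)).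
have Pq x : P x <-> x \in q.
  split=> [Px|/mapP[f]].
    have xs i : x i \in s i by case: (sP i) => _ /(_ (x i)) [+ _] _; apply; exact: Px.
    apply/mapP; exists [ffun i => Ordinal (sK i _ (xs i))].
      by rewrite mem_enum; apply/familyP => i; rewrite ffunE inE /= xs.
    by apply/ffunP => i; rewrite !ffunE.
  rewrite mem_enum => /familyP fF -> i; rewrite ffunE.
  by case: (sP i) => _ /(_ (f i)) [_ +] _; apply; exact: (fF i).
have fP : finite_set P.
  by apply/finite_seqP; exists q; apply/seteqP; split=> x /Pq.
split=> //.
rewrite (@card_seqE _ _ q) //; last by rewrite map_inj_uniq // enum_uniq.
rewrite size_map -cardE card_family foldrE big_image /=.
apply: eq_bigr => i _; case: (sP i) => us _ <-.
rewrite cardE -(size_map val); apply/perm_size/uniq_perm => //.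
  by rewrite map_inj_uniq ?enum_uniq //; exact: val_inj.
move=> t; apply/mapP/idP => [[u]|ts].
  by rewrite mem_enum => us2 ->.
by exists (Ordinal (sK i t ts)); rewrite ?mem_enum.
Qed.

Lemma card_pi (I : finType) (A : I -> set nat) :
  (forall i, finite_set (A i)) ->
  card [set x : {ffun I -> nat} | forall i, A i (x i)] = \prod_i card (A i).
Proof. by move=> /finite_pi_card[]. Qed.

Lemma finite_pi (I : finType) (A : I -> set nat) :
  (forall i, finite_set (A i)) ->
  finite_set [set x : {ffun I -> nat} | forall i, A i (x i)].
Proof. by move=> /finite_pi_card[]. Qed.

(** Double counting: once the sums are exchanged, each element of [A] contributes to at most one
    index. The [Q i] may be infinite, since only their traces on [A] are counted. *)
Lemma sum_card_disj_le (T : choiceType) (I : finType) (A : set T)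
    (Q : I -> set T) : finite_set A ->
  (forall i j x, Q i x -> Q j x -> i = j) ->
  (\sum_i card (A `&` Q i) <= card A)%N.
Proof.
move=> fA Qdisj; have [s [us As sA]] := finite_card_seq fA.
have cE i : card (A `&` Q i) = (\sum_(x <- s) `[< Q i x >])%N.
  rewrite (@card_seqE _ _ [seq x <- s | `[< Q i x >]]) ?filter_uniq //.
    by rewrite size_filter -sum1_count big_mkcond /=; apply: eq_bigr => x _; case: asboolP.
  move=> x; rewrite mem_filter; split=> [[/As -> Qx]|/andP[/asboolP Qx /As Ax]] //.
  by rewrite andbT; apply/asboolP.
under eq_bigr do rewrite cE.
rewrite exchange_big /= -sA -sum1_size leq_sum // => x _.
have [[i Qix]|nQ] := pselect (exists i, Q i x).
  rewrite (bigD1 i) //= big1 ?addn0 ?leq_b1 // => j ji.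
  by case: asboolP => // Qjx; rewrite (Qdisj i j x) ?eqxx // in ji.
by rewrite big1 // => j _; case: asboolP => // Qj; case: nQ; exists j.
Qed.

End Cardinality.

(** * Generating sets and irreducible elements *)

Section Generators.

Set Implicit Arguments.
Unset Strict Implicit.
Unset Printing Implicit Defensive.
Import GRing.Theory.
Local Open Scope classical_set_scope.
Local Open Scope ring_scope.
Local Notation card := Defs.card.

Lemma submonoid_smallest (V : nmodType) (A : set V) :
  submonoid (smallest (@submonoid V) A).
Proof.
split=> [B [[B0 _] _] //|x y xA yA B BA].
by case: (BA) => -[_ BD] _; apply: BD; [exact: xA|exact: yA].
Qed.

Lemma submonoid_sum (V : nmodType) (A : set V) (I : Type) (r : seq I)
    (F : I -> V) :
  submonoid A -> (forall i, A (F i)) -> A (\sum_(i <- r) F i).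
Proof. by move=> [A0 AD] AF; elim/big_rec: _ => // i x _ Ax; apply: AD. Qed.

Lemma embdim_le (V : nmodType) (A S : set V) :
  finite_set A -> smallest (@submonoid V) A = S -> (embdim S <= card A)%N.
Proof.
move=> fA AS; case: (@leastP [set m | exists B : set V,
    [/\ finite_set B, smallest (@submonoid V) B = S & card B = m]]).
  by exists (card A), A.
by move=> _; apply; exists A.
Qed.

Lemma embdim_witness (V : nmodType) (B S : set V) :
  finite_set B -> smallest (@submonoid V) B = S ->
  exists A : set V,
    [/\ finite_set A, smallest (@submonoid V) A = S & card A = embdim S].
Proof.
move=> fB BS; case: (@leastP [set m | exists A : set V,
    [/\ finite_set A, smallest (@submonoid V) A = S & card A = m]]) => //.
by exists (card B), B.
Qed.

(** If [x] were missing from [A], then [S] without [x] would be a submonoid containing [A], hence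
    all of [S]: irreducibility gives closure under sums of nonzero elements, and [x <> 0] keeps [0]
    inside. *)
Lemma atom_in_generators (V : nmodType) (A S : set V) (x : V) :
  submonoid S -> smallest (@submonoid V) A = S -> S x -> x <> 0 ->
  (forall y z, S y -> S z -> y <> 0 -> z <> 0 -> y + z <> x) -> A x.
Proof.
move=> [S0 SD] AS Sx x0 xatom; apply: contrapT => nAx.
have : smallest (@submonoid V) A `<=` S `&` [set y | y <> x].
  apply: smallest_sub.
    split=> [|y z [Sy yx] [Sz zx]]; first by split=> //= /esym.
    split; first exact: SD.
    have [->|/eqP y0] := eqVneq y 0; first by rewrite add0r.
    have [->|/eqP z0] := eqVneq z 0; first by rewrite addr0.
    exact: xatom.
  move=> y Ay; split; last by move=> /= yx; apply: nAx; rewrite -yx.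
  by rewrite -AS; exact: sub_gen_smallest.
by rewrite AS => /(_ x Sx) [_]; apply.
Qed.

End Generators.

(** * The generating number, the coordinate monoids and finite generation *)

Section Unipotent.

Set Implicit Arguments.
Unset Strict Implicit.
Unset Printing Implicit Defensive.
Import GRing.Theory.
Local Open Scope classical_set_scope.
Local Notation card := Defs.card.

Variables (n : nat) (S : set (unip n)).
Hypothesis hS : unipotent_numerical S.
Let d := n.-1.
Let k := generating_number S.
Let T := coord_monoid S.
Implicit Types (i j : 'I_n.-1) (x y : unip n) (t : nat).

Definition axis j t : unip n :=
  [ffun i => if i == j then t else 0].

Lemma generating_numberP :
  (0 < k)%N /\ forall x j, (k <= x j)%N -> S x.
Proof.
case: hS => -[S0 _] /finite_card_seq[s [_ sP _]].
have [|[k0 kS] _] := @leastP [set k | (0 < k)%N /\ @Pset n k `<=` S].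
  (* [s] lists the gaps, so one more than the largest coordinate of a gap is admissible. *)
  exists (\max_(x <- s) \max_i x i).+1; split=> // x [x0|xs].
    by rewrite (_ : x = 0%R) //; apply/ffunP => i; rewrite x0 ffunE.
  apply: contrapT => /sP xins; move: xs.
  by rewrite ltnNge (@leq_bigmax_seq _ _ xpredT (fun x : unip n => \max_i x i)).
split=> // x j kx; apply: kS; right.
exact: leq_trans (leq_bigmax j).
Qed.

Lemma k_gt0 : (0 < k)%N. Proof. by case: generating_numberP. Qed.

Lemma S_of_large x j : (k <= x j)%N -> S x.
Proof. by case: generating_numberP => _; apply. Qed.

Lemma coord_monoidE j t : T j t <-> S (axis j t).
Proof.
split=> [[x [Sx x0] <-]|Sx]; last first.
  exists (axis j t); last by rewrite ffunE eqxx.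
  by split=> // i ij; rewrite ffunE (negPf ij).
rewrite (_ : axis _ _ = x) //; apply/ffunP => i; rewrite ffunE.
by case: eqVneq => [->|ij] //; rewrite x0.
Qed.

Lemma axisD j t u : axis j (t + u) = (axis j t + axis j u)%R.
Proof. by apply/ffunP => i; rewrite !ffunE; case: eqP. Qed.

Lemma axis0 j : axis j 0 = 0%R.
Proof. by apply/ffunP => i; rewrite !ffunE; case: eqP. Qed.

Lemma sum_axis x : x = (\sum_i axis i (x i))%R.
Proof.
apply/ffunP => j; rewrite sum_ffunE (bigD1 j) //= big1.
  by rewrite ffunE eqxx addr0.
by move=> i ij; rewrite ffunE eq_sym (negPf ij).
Qed.

Lemma submonoid_coord j : submonoid (T j).
Proof.
case: hS => -[S0 SD] _; split=> [|t u /coord_monoidE St /coord_monoidE Su].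
  by apply/coord_monoidE; rewrite axis0.
by apply/coord_monoidE; rewrite axisD; apply: SD.
Qed.

Lemma S_of_coords x : (forall i, T i (x i)) -> S x.
Proof.
move=> Tx; rewrite (sum_axis x); apply: submonoid_sum; first by case: hS.
by move=> i; apply/coord_monoidE.
Qed.

Lemma coord_large j t : (k <= t)%N -> T j t.
Proof.
by move=> kt; apply/coord_monoidE/(@S_of_large _ j); rewrite ffunE eqxx.
Qed.

(** By [coord_large] the set that defines the conductor contains [k], so [least] takes no junk
    value. *)
Lemma conductorP j : [/\ (0 < conductor (T j))%N,
   (forall t, conductor (T j) <= t -> T j t)%N,
   (forall c, 0 < c -> (forall t, c <= t -> T j t) -> conductor (T j) <= c)%N
   & (conductor (T j) <= k)%N].
Proof.
pose P := [set c | (0 < c)%N /\ forall t, (c <= t)%N -> T j t].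
have kc : P k.
  by split; [exact: k_gt0|exact: coord_large].
have [|[c0 cT] cmin] := @leastP P; first by exists k.
split=> //; last exact: cmin kc.
by move=> c c0' cT'; apply: cmin.
Qed.

Definition multiplicity (U : set nat) : nat := least [set t | U t /\ (0 < t)%N].
Let m j := multiplicity (T j).

Lemma multiplicityP j : [/\ T j (m j), (0 < m j)%N,
   (forall t, T j t -> 0 < t -> m j <= t)%N & (m j <= k)%N].
Proof.
pose P := [set t | T j t /\ (0 < t)%N].
have km : P k.
  by split; [exact: coord_large|exact: k_gt0].
have [|[mT m0] mmin] := @leastP P; first by exists k.
split=> //; last exact: mmin km.
by move=> t Tt t0; apply: mmin.
Qed.

(** If some [x j] is at least [k + k], then [axis j k] splits off and leaves a remainder whose
    [j]-th coordinate is still at least [k], hence in [S]; induct on the coordinate sum. This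
    ensures that [embdim S] is attained by a finite generating set. *)
Lemma finitely_generated :
  exists B : set (unip n), finite_set B /\ smallest (@submonoid _) B = S.
Proof.
case: (hS) => SM _.
pose B := S `&` [set x | forall i, (x i < k + k)%N].
exists B; split.
  have fI (i : 'I_n.-1) : finite_set [set t | (t < k + k)%N] by exact: finite_II.
  apply: sub_finite_set (finite_pi fI).
  by move=> x [].
apply/seteqP; split; first by apply: smallest_sub => // x [].
suff Bgen N x : (\sum_i x i < N)%N -> S x -> smallest (@submonoid _) B x.
  by move=> x Sx; exact: (Bgen (\sum_i x i).+1).
elim: N x => // N IH x xN Sx.
have [xB|/existsNP[j /negP]] := pselect (forall i, (x i < k + k)%N).
  exact: sub_gen_smallest.
rewrite -leqNgt => xj; have k0 := k_gt0.
pose y : unip n := [ffun i => if i == j then x j - k else x i].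
have -> : x = (axis j k + y)%R.
  apply/ffunP => i; rewrite !ffunE; case: eqP => [->|_]; last by rewrite add0r.
  by rewrite [RHS]subnKC //; lia.
case: (submonoid_smallest B) => _ BD; apply: BD.
  apply: sub_gen_smallest; split.
    by apply: (@S_of_large _ j); rewrite ffunE eqxx.
  by move=> i; rewrite ffunE; case: eqP => _; lia.
apply: IH; last by apply: (@S_of_large _ j); rewrite ffunE eqxx; lia.
move: xN; rewrite ltnS; apply: leq_trans.
rewrite (bigD1 j) //= [X in (_ < X)%N](bigD1 j) //= ffunE eqxx -addSn leq_add //.
  by lia.
by apply: leq_sum => i ij; rewrite ffunE (negPf ij).
Qed.

(** * Generators on the axes, and sporadicity *)

Let line j : set (unip n) := [set x | forall i, i != j -> x i = 0%N].

Lemma line_axis j x : line j x -> x = axis j (x j).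
Proof.
move=> xj; apply/ffunP => i; rewrite ffunE.
by case: eqVneq => [->|/xj].
Qed.

(** In natural numbers a sum lies on an axis only if all summands do, so the generators of [S] on
    the [j]-th axis already generate [T j]. The condition [0 < x j] discards the zero vector, which
    lies on every axis. *)
Lemma embdim_coord_le (A : set (unip n)) j :
  finite_set A -> smallest (@submonoid _) A = S ->
  (embdim (T j) <= card (A `&` (line j `&` [set x | 0 < x j]%N)))%N.
Proof.
move=> fA AS; set L := A `&` _; pose f x := x j.
have fL : finite_set L by apply: sub_finite_set fA => x [].
have TM := submonoid_coord j.
have LT : f @` L `<=` T j.
  move=> _ [x [Ax [xj _]] <-]; apply/coord_monoidE; rewrite -line_axis //.
  by rewrite -AS; exact: sub_gen_smallest.
apply: leq_trans (card_image_le f fL).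
apply: embdim_le; first exact: finite_image.
apply/seteqP; split; first exact: smallest_sub.
move=> t /coord_monoidE.
have [G0 GD] := submonoid_smallest (f @` L).
have : smallest (@submonoid _) A
    `<=` [set x | line j x -> smallest (@submonoid _) (f @` L) (x j)].
  apply: smallest_sub.
    split=> [_|x y IHx IHy xyj] /=; first by rewrite ffunE.
    rewrite ffunE; apply: GD; [apply: IHx|apply: IHy] => i /xyj;
      by rewrite ffunE => /eqP; rewrite addn_eq0 => /andP[/eqP ? /eqP ?].
  move=> x Ax xj; have [->|x0] := posnP (x j); first exact: G0.
  by apply: sub_gen_smallest; exists x.
rewrite AS => /[apply] /=; rewrite ffunE eqxx; apply=> i ij.
by rewrite ffunE (negPf ij).
Qed.

(** The multiples of [m j] below the conductor are sporadic elements of [T j]. *)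
Lemma leq_k_mult_sporadicity j :
  conductor (T j) = k -> (k <= m j * sporadicity (T j))%N.
Proof.
move=> cE; have [mT m0 _ mk] := multiplicityP j; have k0 := k_gt0.
have TM t : T j (t * m j)%N.
  have [T0 TD] := submonoid_coord j.
  by elim: t => [|t IH]; [exact: T0|rewrite mulSn; exact: TD].
(* [q] is the ceiling of [k / m j], the number of multiples of [m j] below [k], zero included. *)
pose q := (k.-1 %/ m j).+1.
apply: (@leq_trans (m j * q)); first by rewrite mulnC -ltnS -{1}(ltn_predK k0) ltnS ltn_ceil.
rewrite leq_mul2l; apply/orP; right.
rewrite -[leqLHS]card_ltn -(@card_image_inj _ _ (muln^~ (m j))); first last.
- by move=> x y /eqP; rewrite eqn_pmul2r // => /eqP.
- exact: finite_II.
apply: card_le; first by apply: (@finite_bounded _ k) => t []; rewrite cE.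
move=> _ [t /= tq <-]; split; first exact: TM.
rewrite cE -(ltn_predK k0) ltnS (leq_trans _ (leq_trunc_div _ (m j))) //.
by rewrite leq_mul2r -ltnS tq orbT.
Qed.

Lemma sporadicityM_box : sporadicityM S = card [set x | S x /\ forall i, (x i < k)%N].
Proof.
case: hS => -[S0 _] _; have k0 := k_gt0.
rewrite /sporadicityM -/k; congr card; apply/seteqP; split=> x /=.
  move=> [->|[Sx nP]]; first by split=> // i; rewrite ffunE.
  split=> // i; rewrite ltnNge; apply/negP => kx; apply: nP; right.
  exact: leq_trans (leq_bigmax i).
move=> [Sx xk]; have [->|/eqP x0] := eqVneq x 0%R; first by left.
right; split=> // -[x0'|].
  by apply: x0; apply/ffunP => i; rewrite x0' ffunE.
apply/negP; rewrite -ltnNge -(ltn_predK k0) ltnS; apply/bigmax_leqP => i _.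
by rewrite -ltnS (ltn_predK k0).
Qed.

(** * Consequences of the product hypothesis and of thinness *)

Hypothesis hprod : (\prod_i conductor (T i))%N = (k ^ d)%N.

(** No factor exceeds [k > 0], so a single smaller factor would make the product strictly smaller
    than [k ^ d]. *)
Lemma conductor_eq j : conductor (T j) = k.
Proof.
have ck i : (conductor (T i) <= k)%N by case: (conductorP i).
apply/eqP; rewrite eqn_leq ck leqNgt; apply/negP => cjk.
have : (\prod_i conductor (T i) < \prod_(i < d) k)%N.
  rewrite (bigD1 j) //= [ltnRHS](bigD1 j) //=.
  apply: (@leq_ltn_trans (conductor (T j) * \prod_(i < d | i != j) k)).
    by rewrite leq_mul2l leq_prod ?orbT.
  by rewrite ltn_pmul2r // prodn_gt0 // => i; exact: k_gt0.
by rewrite hprod prod_nat_const card_ord ltnn.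
Qed.

Hypothesis hthin : thin S.

(** The product of the sets of sporadic elements of the [T i] is contained in the part of [S] inside
    the box; thinness gives both the same finite cardinality, so they coincide. *)
Lemma thin_box x : S x -> (forall i, (x i < k)%N) -> forall i, T i (x i).
Proof.
pose A i := [set t | T i t /\ (t < k)%N].
have fA i : finite_set (A i) by apply: (@finite_bounded _ k) => t [].
have fk (i : 'I_n.-1) : finite_set [set t | (t < k)%N] by exact: finite_II.
pose B := [set x | S x /\ forall i, (x i < k)%N].
have fB : finite_set B by apply: sub_finite_set (finite_pi fk) => y [].
suff AB : [set x : unip n | forall i, A i (x i)] = B.
  by move=> Sx xk i; have : B x by []; rewrite -AB => /(_ i)[].
apply: card_sub_eq => //.
  move=> y Ay; split=> [|i]; last by case: (Ay i).
  by apply: S_of_coords => i; case: (Ay i).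
rewrite card_pi // -sporadicityM_box -hthin; apply: eq_bigr => i _.
by rewrite /sporadicity conductor_eq.
Qed.

(** * Irreducible elements off the axes *)

Let slab j : set (unip n) := [set x | forall i,
  (if i == j then [set t | k <= t < k + m i]%N else [set t | t < m i]%N) (x i)].

Lemma slabP j x : slab j x <->
  (k <= x j < k + m j)%N /\ (forall i, i != j -> (x i < m i)%N).
Proof.
split=> [xs|[xj xs] i]; last by case: eqVneq => [->//|/xs].
split=> [|i ij]; first by have := xs j; rewrite eqxx.
by have := xs i; rewrite (negPf ij).
Qed.

Lemma finite_slab_factor j i :
  finite_set (if i == j then [set t | k <= t < k + m i]%N else [set t | t < m i]%N).
Proof.
case: eqP => _; last exact: finite_II.
by apply: (@finite_bounded _ (k + m i)) => t /= /andP[].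
Qed.

Lemma finite_slab j : finite_set (slab j).
Proof. exact: (finite_pi (@finite_slab_factor j)). Qed.

(** Each factor is an interval of length [m i]; the [j]-th one is only translated by [k]. *)
Lemma card_slab j : card (slab j) = (\prod_i m i)%N.
Proof.
rewrite (card_pi (@finite_slab_factor j)).
by apply: eq_bigr => i _; case: eqP => _; [exact: card_interval|exact: card_ltn].
Qed.

(** A slab element on the [j]-th axis is determined by its [j]-th coordinate, which ranges over an
    interval of length [m j]. *)
Lemma card_slab_off_line j : (\prod_i m i - m j <= card (slab j `\` line j))%N.
Proof.
have fs := finite_slab j.
rewrite leq_subLR -(card_slab j).
have fl : finite_set (slab j `&` line j) by apply: sub_finite_set fs => x [].
have fo : finite_set (slab j `\` line j) by apply: sub_finite_set fs => x [].
have -> : card (slab j) = (card (slab j `&` line j) + card (slab j `\` line j))%N.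
  rewrite -cardU_disj // ?setUIDK //.
  by apply/seteqP; split=> x // [[_ ?] []].
rewrite leq_add2r -[leqRHS](card_interval k).
apply: (@leq_trans (card (axis j @` [set t | k <= t < k + m j]%N))); last first.
  by apply/card_image_le/(@finite_bounded _ (k + m j)) => t /= /andP[].
apply: card_le.
  by apply/finite_image/(@finite_bounded _ (k + m j)) => t /= /andP[].
move=> x [/slabP[xj _] xl]; exists (x j) => //.
by rewrite -line_axis.
Qed.

(* For i <> j the coordinates of a slab element x are below m i.  So a nonzero
   summand y of x in S with y j < k lies in the box and, by thinness, on the
   j-th axis, where y j >= m j; as x j < k + m j, x cannot split. *)
Lemma slab_atom (A : set (unip n)) j :
  smallest (@submonoid _) A = S -> slab j `\` line j `<=` A.
Proof.
move=> AS x [/slabP[/andP[kx xk] xm] xl].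
apply: (atom_in_generators (proj1 hS) AS); first exact: S_of_large kx.
  by move=> x0; apply: xl => i _; rewrite x0 ffunE.
have mk i : (m i <= k)%N by case: (multiplicityP i).
have summand y : S y -> y <> 0%R -> (forall i, y i <= x i)%N ->
    (k <= y j)%N \/ (line j y /\ (m j <= y j)%N).
  move=> Sy y0 yx; have [|yk] := leqP k (y j); [by left|right].
  have ybox i : (y i < k)%N.
    have [->//|ij] := eqVneq i j.
    by rewrite (leq_ltn_trans (yx i)) // (leq_trans (xm i ij)).
  have Ty := thin_box Sy ybox.
  have yl : line j y.
    move=> i ij; have [_ _ /(_ _ (Ty i)) + _] := multiplicityP i.
    by have := leq_ltn_trans (yx i) (xm i ij); case: (y i) => // t; lia.
  split=> //; have [_ _ mmin _] := multiplicityP j; apply: mmin => //.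
  rewrite lt0n; apply/eqP => yj; apply: y0.
  by rewrite (line_axis yl) yj axis0.
suff nosplit (y z : unip n) :
    S y -> S z -> y <> 0%R -> z <> 0%R -> (y + z)%R <> x by exact: nosplit.
move=> Sy Sz y0 z0 yz.
have xE i : x i = (y i + z i)%N by rewrite -yz ffunE.
have yx i : (y i <= x i)%N by rewrite xE leq_addr.
have zx i : (z i <= x i)%N by rewrite xE leq_addl.
have xj := xE j; have mj := mk j.
have [ky|[yl my]] := summand y Sy y0 yx;
  have [kz|[zl mz]] := summand z Sz z0 zx; try lia.
by apply: xl => i ij; rewrite xE yl // zl.
Qed.

Lemma leq_sum_generators (A : set (unip n)) :
  finite_set A -> smallest (@submonoid _) A = S ->
  (\sum_j (embdim (T j) + (\prod_i m i - m j)) <= card A)%N.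
Proof.
move=> fA AS.
(* [Q j] holds both kinds of generators attached to [j]. These regions are disjoint: for [x] in
   [Q i] and [Q j] with [i <> j], the bound [x i < m i <= k] forces [x] onto the [i]-th axis,
   against [0 < x j]. *)
pose Q j := [set x : unip n | [/\ (0 < x j)%N,
  forall i, i != j -> (x i < m i)%N & line j x \/ (k <= x j)%N]].
apply: leq_trans (@sum_card_disj_le _ _ A Q fA _); last first.
  move=> i j x [xi xim xil] [xj xjm xjl]; apply/eqP; apply: contraT => ij.
  have [_ _ _ mik] := multiplicityP i.
  have xilt := xjm _ ij; case: xil => [xl|]; last by lia.
  by move: xj; rewrite xl // eq_sym.
apply: leq_sum => j _.
apply: (leq_trans (leq_add (embdim_coord_le j fA AS) (card_slab_off_line j))).
rewrite -cardU_disj; first last.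
- by apply/seteqP; split=> x // [[_ [? _]] [_]].
- by apply: sub_finite_set (finite_slab j) => x [].
- by apply: sub_finite_set fA => x [].
apply: card_le; first by apply: sub_finite_set fA => x [].
have k0 := k_gt0.
move=> x [[Ax [xl xj]]|xs]; split=> //.
- split=> //; last by left.
  by move=> i ij; rewrite xl //; case: (multiplicityP i).
- exact: slab_atom xs.
- case: xs => /slabP[/andP[kx _] xm] _; split=> //; last by right.
  exact: leq_trans kx.
Qed.

(** * The Wilf inequalities *)

Hypothesis hWilf : forall i,
  (conductor (T i) <= embdim (T i) * sporadicity (T i))%N.

Lemma expn_leq_summand j :
  (k ^ d <= (embdim (T j) + (\prod_i m i - m j)) * \prod_i sporadicity (T i))%N.
Proof.
have km i := leq_k_mult_sporadicity (conductor_eq i).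
have ke : (k <= embdim (T j) * sporadicity (T j))%N by rewrite -{1}(conductor_eq j).
set e := embdim (T j) in ke *.
rewrite -[X in (_ ^ X <= _)%N]card_ord -prod_nat_const (bigD1 j) //=.
rewrite [X in (X - _)%N](bigD1 j) //= [X in (_ <= _ * X)%N](bigD1 j) //=.
set K := (\prod_(i < _ | _) k)%N; set P := (\prod_(i | _) m i)%N.
set R := (\prod_(i | _) sporadicity _)%N.
have P0 : (0 < P)%N by rewrite prodn_gt0 // => i; case: (multiplicityP i).
have KPR : (K <= P * R)%N by rewrite -big_split; apply: leq_prod => i _; exact: km.
(* Both [e] and [m j] give at least [k] when multiplied by the sporadicity of [T j], so their
   minimum does too. *)
have kmin : (k <= minn e (m j) * sporadicity (T j))%N.
  by rewrite /minn; case: (e < m j)%N; [exact: ke|exact: km].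
apply: (leq_trans (leq_mul kmin KPR)).
rewrite mulnACA leq_mul2r; apply/orP; right.
(* It remains to see that [minn e (m j) * P <= e + (m j * P - m j)]. As [P >= 1], the subtraction is
   exact and the right side is [e + m j * (P - 1)]. *)
rewrite /minn; case: (ltnP e (m j)) => [/ltnW em|em]; nia.
Qed.

Lemma unipotent_Wilf_thin : unipotent_Wilf S.
Proof.
have [B [fB BS]] := finitely_generated.
have [A [fA AS cA]] := embdim_witness fB BS.
rewrite /unipotent_Wilf -hthin -/k -cA.
apply: leq_trans (leq_mul (leq_sum_generators fA AS) (leqnn _)).
rewrite big_distrl /= -[X in (X * _ <= _)%N]card_ord -sum_nat_const.
by apply: leq_sum => j _; exact: expn_leq_summand.
Qed.

(* The corner (k-1, ..., k-1) of the box is a gap: k-1 lies in no T j. *)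
Lemma below_gaps_box (d_gt0 : (0 < d)%N) : (1 < k)%N ->
  below_gaps S = [set x | forall i, (x i < k)%N].
Proof.
move=> k1; apply/seteqP; split=> x.
  move=> [b bS xb] i; rewrite ltnNge; apply/negP => kx.
  by apply: bS; apply: (@S_of_large _ i); exact: leq_trans (xb i).
move=> xk; exists [ffun=> k.-1]; last first.
  by move=> i; rewrite ffunE -ltnS (ltn_predK k1).
pose j0 : 'I_n.-1 := Ordinal d_gt0; pose b : unip n := [ffun=> k.-1].
have bk i : (b i < k)%N by rewrite ffunE; lia.
move=> Sb; have := @thin_box b Sb bk j0; rewrite ffunE => Tk.
have [_ cT cmin _] := conductorP j0.
(* If [k.-1] were in [T j0], it would satisfy the defining property of the conductor, being positive
   because [1 < k]. *)
suff : (conductor (T j0) <= k.-1)%N by rewrite conductor_eq; lia.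
apply: cmin => [|t kt]; first by lia.
have [<- //|tk] := eqVneq k.-1 t.
by apply: coord_large; lia.
Qed.

(* For k = 1 there are no gaps, so both sides vanish. *)
Lemma generalized_Wilf_thin (d_gt0 : (0 < d)%N) : generalized_Wilf S.
Proof.
have [k1|k1] := leqP k 1.
  rewrite /generalized_Wilf /gen_c (_ : below_gaps S = set0).
    by rewrite /Defs.card fset_set0 cardfs0 muln0.
  rewrite -subset0 => x [b bS _]; apply: bS.
  have [/forallP b0|/forallPn [i bi]] := boolP [forall i, b i == 0].
    rewrite (_ : b = 0%R); first by case: hS => -[].
    by apply/ffunP => i; rewrite ffunE; apply/eqP.
  by apply: (@S_of_large _ i); rewrite (leq_trans k1) // lt0n.
rewrite /generalized_Wilf /gen_c /gen_n below_gaps_box //.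
rewrite (@card_pi _ (fun=> [set t | (t < k)%N])); last by move=> i; exact: finite_II.
rewrite card_ltn prod_nat_const card_ord -sporadicityM_box.
exact: unipotent_Wilf_thin.
Qed.

End Unipotent.

Theorem theorem6p11 (n : nat) (hn : (2 <= n)%N) (S : set (unip n))
  (hS : unipotent_numerical S) (hthin : thin S)
  (hWilf : forall i : 'I_n.-1,
     (conductor (coord_monoid S i)
        <= embdim (coord_monoid S i) * sporadicity (coord_monoid S i))%N)
  (hprod : (\prod_(i < n.-1) conductor (coord_monoid S i))%N
             = (generating_number S ^ n.-1)%N) :
  unipotent_Wilf S /\ (unipotent_Wilf S <-> generalized_Wilf S).
Proof.
have uW := unipotent_Wilf_thin hS hprod hthin hWilf.
have d_gt0 : (0 < n.-1)%N by move: hn; case: (n) => [|[]].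
have gW := generalized_Wilf_thin hS hprod hthin hWilf d_gt0.
(* Both inequalities hold, so their equivalence is immediate. *)
by [].
Qed.
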